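(* Let $T(x)$ be the transfer matrix for 2D fermions. For all $u,w\in S_{\mathbb Z}$ and $n\ge1$, $$\langle u|T(x_n)\cdots T(x_2)T(x_1)|w\rangle=\mathfrak F_{w/u}(x_1,\dots,x_n),$$ the skew Stanley symmetric polynomial in $n$ variables.
   Context: **Permutations.** $S_{\mathbb Z}$ is the group of permutations of $\mathbb Z$ with finite support, generated by $s_i=(i\ i{+}1)$, $i\in\mathbb Z$, with length $\ell$; products are compositions, $(ws_i)(j)=w(s_i(j))$. Write $w\doteq u_1\cdots u_r$ if $w=u_1\cdots u_r$ and $\ell(w)=\sum\ell(u_i)$. $\mathbb F$ is the vector space with basis $\{|w\rangle:w\in S_{\mathbb Z}\}$, and $\langle u|A|w\rangle$ is the coefficient of $|u\rangle$ in $A|w\rangle$. **2D fermions and tiles.** A permutation $w$ is viewed as a 2D Maya diagram in which column $c\in\mathbb Z$ contains particles exactly in the rows $[w(c),\infty)$. Time evolution (particles moving to the left along rows) is encoded by one-row tilings. A tile has a top label $a\in\mathbb Z$, a bottom label $b\in\mathbb Z$, a left edge $I$ and a right edge $J$ (finite, possibly empty, intervals of $\mathbb Z$, where $[p,q)$ denotes $\{p,\dots,q-1\}$). The allowed tiles $(a,b;I,J)$ and their weights are: - $a=b$, $I=J=\emptyset$, weight $1$; - $a>b$, $I=\emptyset$, $J=[b,a)$, weight $1$; - $a<b$, $I=[a,b)$, $J=\emptyset$, weight $x$; - $i<\min(a,b)$ for some $i\in\mathbb Z$, $I=[i,b)$, $J=[i,a)$, weight $x$. A one-row tiling with top boundary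 $w$ and bottom boundary $u$ assigns to each column $c\in\mathbb Z$ an allowed tile with top label $w(c)$ and bottom label $u(c)$, such that the right edge of the tile in column $c$ equals the left edge of the tile in column $c+1$ for all $c$, and all but finitely many edges are empty. Its weight is the product of the weights of its tiles. The transfer matrix is $T(x)|w\rangle=\sum_u Z_{w/u}(x)|u\rangle$, where $Z_{w/u}(x)$ is the sum of the weights of all one-row tilings with top $w$ and bottom $u$. **Skew Stanley polynomials.** A permutation is increasing if it is the identity or has a reduced word $s_{a_1}\cdots s_{a_m}$ with $a_1<\cdots<a_m$. For $v\in S_{\mathbb Z}$, $\mathfrak F_v(x_1,\dots,x_n)=\sum x_1^{\ell(v_1)}\cdots x_n^{\ell(v_n)}$ over tuples of increasing permutations with $v\doteq v_1v_2\cdots v_n$ (a symmetric polynomial). $\mathfrak F_{w/u}:=\mathfrak F_{u^{-1}w}$ if $w\doteq u\cdot(u^{-1}w)$, and $\mathfrak F_{w/u}:=0$ otherwise. *)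

(* Defs.v *)
From HB Require Import structures.
From mathcomp Require Import all_boot all_order all_algebra finmap.
From mathcomp Require Import boolp classical_sets functions cardinality fsbigop.
From mathcomp Require Import freeg.
From mathcomp Require Import zify.

Set Implicit Arguments.
Unset Strict Implicit.
Unset Printing Implicit Defensive.

Import Order.TTheory GRing.Theory Num.Theory.

Local Open Scope classical_set_scope.
Local Open Scope ring_scope.

Definition finite_perm (f : int -> int) : bool :=
  `[< bijective f /\ finite_set [set i | f i != i] >].

Record SZ := MkSZ { szfun :> int -> int; _ : finite_perm szfun }.

HB.instance Definition _ := [isSub for szfun].
HB.instance Definition _ := [Choice of SZ by <:].

Lemma SZ_bij (w : SZ) : bijective w.
Proof. by case: w => f /= /asboolP []. Qed.

Lemma SZ_fin (w : SZ) : finite_set [set i | w i != i].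
Proof. by case: w => f /= /asboolP []. Qed.

Lemma SZ_ext (u w : SZ) : u =1 w -> u = w.
Proof. by move=> uw; apply: val_inj; apply: funext. Qed.

Lemma finite_perm_id : finite_perm id.
Proof.
apply/asboolP; split; first by exists id.
rewrite [X in finite_set X](_ : _ = set0) //.
by rewrite predeqE => i; split => //=; rewrite eqxx.
Qed.

Lemma finite_perm_comp (u w : SZ) : finite_perm (u \o w).
Proof.
apply/asboolP; split; first exact: bij_comp (SZ_bij u) (SZ_bij w).
have fin : finite_set ([set i | u i != i] `|` [set i | w i != i]).
  by rewrite finite_setU; split; exact: SZ_fin.
apply: sub_finite_set fin => i /= uwi.
have [wi|wi] := eqVneq (w i) i; last by right.
by left; rewrite wi in uwi.
Qed.

Lemma SZ_inv_ex (w : SZ) : exists g : SZ, cancel w g /\ cancel g w.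
Proof.
have [g wK gK] := SZ_bij w.
suff gP : finite_perm g by exists (MkSZ gP).
apply/asboolP; split; first by exists w.
apply: sub_finite_set (SZ_fin w) => i /=.
by apply: contraNN => /eqP wi; rewrite -{1}wi wK.
Qed.

Definition SZ_one : SZ := MkSZ finite_perm_id.
Definition SZ_mul (u w : SZ) : SZ := MkSZ (finite_perm_comp u w).
Definition SZ_inv (w : SZ) : SZ := sval (cid (SZ_inv_ex w)).

Lemma SZ_mulA : associative SZ_mul.
Proof. by move=> u v w; apply: SZ_ext. Qed.

Lemma SZ_mul1 : left_id SZ_one SZ_mul.
Proof. by move=> w; apply: SZ_ext. Qed.

Lemma SZ_mulr1 : right_id SZ_one SZ_mul.
Proof. by move=> w; apply: SZ_ext. Qed.

Lemma SZ_mulV : left_inverse SZ_one SZ_inv SZ_mul.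
Proof.
move=> w; rewrite /SZ_inv; case: cid => g [wK gK] /=.
exact/SZ_ext/wK.
Qed.

Lemma SZ_mulrV : right_inverse SZ_one SZ_inv SZ_mul.
Proof.
move=> w; rewrite /SZ_inv; case: cid => g [wK gK] /=.
exact/SZ_ext/gK.
Qed.

HB.instance Definition _ :=
  isGroup.Build SZ SZ_mulA SZ_mul1 SZ_mulr1 SZ_mulV SZ_mulrV.

Definition transp (i j : int) : int :=
  if j == i then i + 1 else if j == i + 1 then i else j.

Lemma finite_perm_transp (i : int) : finite_perm (transp i).
Proof.
have transpK : involutive (transp i).
  by move=> j; rewrite /transp; do !case: eqP => //; lia.
apply/asboolP; split; first by exists (transp i).
apply: (@sub_finite_set _ _ [set i; i + 1]) => // j /=.
rewrite /transp; have [->|_] := eqVneq j i; first by left.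
by have [->|_] := eqVneq j (i + 1); [right | rewrite eqxx].
Qed.

Definition s_ (i : int) : SZ := MkSZ (finite_perm_transp i).

Definition word_prod (a : seq int) : SZ := (\prod_(i <- a) s_ i)%g.

Lemma s_E i j :
  s_ i j = if j == i then i + 1 else if j == i + 1 then i else j.
Proof. by []. Qed.

Lemma s_K i : (s_ i * s_ i)%g = 1%g.
Proof.
apply: SZ_ext => j /=; rewrite /transp; do !case: eqP => //; lia.
Qed.

Lemma s_generate (w : SZ) : exists a, w = word_prod a.
Proof.
have [a [n]] : exists (a : int) (n : nat),
    forall j, j < a \/ a + n%:Z <= j -> w j = j.
  have [N wN] : exists N : nat, forall i, w i != i -> (`|i| < N)%N.
    have /finite_fsetP[X wX] := SZ_fin w.
    exists (\max_(i <- X) `|i|%N).+1 => i wi.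
    have iX : i \in X.
      by have : [set i | w i != i] i by []; rewrite wX.
    by rewrite ltnS (bigD1_seq i iX (fset_uniq X)); apply: leq_maxl.
  exists (- N%:Z), (N + N)%N => j hj; apply/eqP; apply: contraT => /wN.
  by case: hj; lia.
elim: n w => [|n IHn] w wid.
  exists [::]; apply: SZ_ext => j; rewrite /word_prod big_nil /=.
  by apply: wid; lia.
have [d] : exists d : nat, w (a + n%:Z) + d%:Z = a + n%:Z.
  have wle : w (a + n%:Z) <= a + n%:Z.
    rewrite leNgt; apply/negP => wgt.
    have /(bij_inj (SZ_bij w)) : w (w (a + n%:Z)) = w (a + n%:Z).
      by apply: wid; lia.
    lia.
  by exists (absz (a + n%:Z - w (a + n%:Z))%R); lia.
have : a <= w (a + n%:Z).
  rewrite leNgt; apply/negP => wlt.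
  have /(bij_inj (SZ_bij w)) : w (w (a + n%:Z)) = w (a + n%:Z).
    by apply: wid; left.
  lia.
elim: d w wid => [|d IHd] w wid wge wd.
  apply: IHn => j hj; have [->|ne] := eqVneq j (a + n%:Z); first by lia.
  by apply: wid; lia.
pose p := w (a + n%:Z).
have [] := IHd (s_ p * w)%g.
- move=> j hj /=; rewrite wid // /transp /p.
  by do !case: eqP => //; move: wge wd hj; lia.
- by rewrite /= /transp -/p eqxx; lia.
- by rewrite /= /transp -/p eqxx; lia.
move=> l hl; exists (p :: l).
rewrite /word_prod big_cons -/(word_prod l) -hl.
by rewrite mulgA s_K mul1g.
Qed.

Lemma word_length_ex (w : SZ) :
  exists m, `[< exists a, size a = m /\ w = word_prod a >].
Proof.
by have [a ->] := s_generate w; exists (size a); apply/asboolP; exists a.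
Qed.

Definition plength (w : SZ) : nat := ex_minn (word_length_ex w).

(* [w ≐ u_1 ... u_r]. *)
Definition reduced_prod (w : SZ) (us : seq SZ) : Prop :=
  w = (\prod_(v <- us) v)%g /\ plength w = (\sum_(v <- us) plength v)%N.

(* The classical set [`[p, q[] of integers is {p, ..., q-1}, and is empty when
   q <= p. *)
Record tile := Tile {
  ttop : int; tbot : int; tleft : set int; tright : set int }.

HB.instance Definition _ := gen_eqMixin tile.
HB.instance Definition _ := gen_choiceMixin tile.

Definition tile_vacant (t : tile) : Prop :=
  [/\ ttop t = tbot t, tleft t = set0 & tright t = set0].

Definition tile_emit (t : tile) : Prop :=
  [/\ tbot t < ttop t, tleft t = set0 & tright t = `[tbot t, ttop t[%classic].

Definition tile_absorb (t : tile) : Prop :=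
  [/\ ttop t < tbot t, tleft t = `[ttop t, tbot t[%classic & tright t = set0].

Definition tile_through (t : tile) : Prop :=
  exists i : int, [/\ i < Num.min (ttop t) (tbot t),
    tleft t = `[i, tbot t[%classic & tright t = `[i, ttop t[%classic].

Definition allowed (t : tile) : Prop :=
  [\/ tile_vacant t, tile_emit t, tile_absorb t | tile_through t].

(* The four kinds of allowed tiles are mutually exclusive (they differ by which
   of the two edges are empty), so this is a well-defined weight. *)
Definition tile_weight (R : comNzRingType) (x : R) (t : tile) : R :=
  if `[< tile_vacant t \/ tile_emit t >] then 1 else x.

(* Every edge of a tiling is the left edge of some column. *)
Definition tilings (w u : SZ) : set (int -> tile) :=
  [set t | [/\ forall c, allowed (t c),
               forall c, ttop (t c) = w c,
               forall c, tbot (t c) = u c,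
               forall c, tright (t c) = tleft (t (c + 1)) &
               finite_set [set c | tleft (t c) <> set0] ]].

(* [\big[op/idx]_(i \in A) F i] ranges over the i in A with F i != idx; it is
   idx by convention if there are infinitely many of those. All supports below
   are finite: in a tiling almost all tiles are vacant, there is at most one
   tiling for given w and u, and for given w only finitely many u have one. *)
Definition tiling_weight (R : comNzRingType) (x : R) (t : int -> tile) : R :=
  \big[*%R/1]_(c \in [set: int]) tile_weight x (t c).

Definition Z_ (R : comNzRingType) (w u : SZ) (x : R) : R :=
  \sum_(t \in tilings w u) tiling_weight x t.

(* The space with basis the kets. Its coefficients are in any commutative ring,
   so that the x_i may be polynomial variables as well as scalars. *)
Definition Fock (R : comNzRingType) := {freeg SZ / R}.

Definition ket (R : comNzRingType) (w : SZ) : Fock R := << w >>.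

Definition bracket (R : comNzRingType) (u : SZ) (A : Fock R -> Fock R)
  (w : SZ) : R := coeff u (A (ket R w)).

(* [fglift] extends a function on the basis linearly. *)
Definition transfer (R : comNzRingType) (x : R) : Fock R -> Fock R :=
  @fglift R {freeg SZ / R} SZ
    (fun w => \sum_(u \in [set: SZ]) Z_ w u x *: (<< u >> : {freeg SZ / R})).

(* T(x_n) ... T(x_2) T(x_1), where x_(i+1) is [x i]: T(x_1) acts first. *)
Definition transfer_prod (R : comNzRingType) (n : nat) (x : 'I_n -> R) :
    Fock R -> Fock R :=
  foldl (fun A i => transfer (x i) \o A) id (enum 'I_n).

Definition increasing (w : SZ) : Prop :=
  w = 1%g \/
  exists a : seq int,
    [/\ sorted <%R a, w = word_prod a & plength w = size a].

(* The value at x_1, ..., x_n, in any commutative ring; the polynomial itself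
   is obtained by taking polynomial variables for the x_i. *)
Definition stanley (R : comNzRingType) (n : nat) (x : 'I_n -> R) (v : SZ) : R :=
  \sum_(t \in [set t : n.-tuple SZ |
                (forall i, increasing (tnth t i)) /\ reduced_prod v t])
    \prod_(i < n) x i ^+ plength (tnth t i).

Definition skew_stanley (R : comNzRingType) (n : nat) (x : 'I_n -> R)
    (w u : SZ) : R :=
  if `[< reduced_prod w [:: u; (u^-1 * w)%g] >] then stanley x (u^-1 * w)%g
  else 0.

(* Main.v *)
Require Import Defs.
From mathcomp Require Import all_boot all_order all_algebra finmap.
From mathcomp Require Import boolp classical_sets cardinality fsbigop.
From mathcomp Require Import freeg zify ring.

Set Implicit Arguments.
Unset Strict Implicit.
Unset Printing Implicit Defensive.

Import Order.TTheory GRing.Theory Num.Theory.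

Local Open Scope classical_set_scope.
Local Open Scope ring_scope.

(** A tile is allowed exactly when there is an integer i, at most both labels,
    such that the left edge is [i, b) and the right edge is [i, a).  So a row
    is a left-to-right machine: while the edge is empty a column either keeps
    its particle or starts a block by receiving a smaller label i, and then
    label i is carried along while each label of the block moves one column to
    the right, until the block is closed by the column whose top label is i.
    On a block of columns p, ..., q this says w = u s_p s_(p+1) ... s_(q-1),
    with the length growing at each factor, and the weight counts the factors.
    Altogether Z_(w/u)(x) is x^l(v) if w = u v with v increasing and lengths
    adding up, and 0 otherwise.

    In terms of functions f on permutations, put
      (h_a(x) f)(u) = f(u) + x f(u s_a) if u(a) < u(a+1), and f(u) otherwise.
    These are the factors 1 + x u_a of the nilCoxeter algebra.  The product
    h_a(x) h_(a+1)(x) ... h_(a+n-1)(x), expanded, is the sum over the increasing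
    v with letters in [a, a+n) ([nil_prod_segment]); applied to the indicator of
    w it gives u |-> Z_(w/u)(x) as soon as w moves nothing outside
    [a, a+n] ([Z_nil_prod]).  That is proved without listing blocks: remove the
    smallest letter a, which on the tiling side empties the edge between columns
    a and a+1 ([edges_shrink], [edges_extend]).

    Hence the coefficients of T(x_n)...T(x_1)|w> are the products of these
    operators with the parameter x_n outermost ([foldl_transfer]), while the
    expansion of the skew Stanley polynomial has x_1 outermost
    ([skew_stanleyE]).  The two agree since the operators with different
    parameters commute ([nil_prod_comm]), a consequence of the Yang-Baxter
    relation ([nil_factor_braid]); this is the symmetry of Stanley
    polynomials. *)

(** * Length and descents *)

Lemma SZ_mulE (u v : SZ) j : (u * v)%g j = u (v j).
Proof. by []. Qed.

(** The instance of [mulgA] whose two sides carry the same canonical structures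
    as products of permutations do, so that [lia] identifies the lengths. *)
Lemma SZ_mulgA (u v w : SZ) : (u * (v * w))%g = (u * v * w)%g.
Proof. exact: mulgA. Qed.

Lemma SZ_inj (u : SZ) : injective u.
Proof. exact: bij_inj (SZ_bij u). Qed.

Lemma SZ_surj (u : SZ) k : exists j, u j = k.
Proof. by have [g _ gK] := SZ_bij u; exists (g k). Qed.

Lemma mul_s_l (u : SZ) a : (u * s_ a)%g a = u (a + 1).
Proof. by rewrite SZ_mulE s_E eqxx. Qed.

Lemma mul_s_r (u : SZ) a : (u * s_ a)%g (a + 1) = u a.
Proof. by rewrite SZ_mulE s_E eqxx; case: eqP => //; lia. Qed.

Lemma mul_s_out (u : SZ) a j : j != a -> j != a + 1 -> (u * s_ a)%g j = u j.
Proof. by move=> /negPf ja /negPf ja1; rewrite SZ_mulE s_E ja ja1. Qed.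

Lemma mul_sK (u : SZ) a : (u * s_ a * s_ a)%g = u.
Proof. by rewrite -mulgA s_K mulg1. Qed.

Lemma word_prod0 : word_prod [::] = 1%g.
Proof. by rewrite /word_prod big_nil. Qed.

Lemma word_prod_cons a c : word_prod (a :: c) = (s_ a * word_prod c)%g.
Proof. by rewrite /word_prod big_cons. Qed.

Lemma word_prod_cat b c : word_prod (b ++ c) = (word_prod b * word_prod c)%g.
Proof. by rewrite /word_prod big_cat. Qed.

Lemma word_prod_rcons c a : word_prod (rcons c a) = (word_prod c * s_ a)%g.
Proof. by rewrite -cats1 word_prod_cat word_prod_cons word_prod0 mulg1. Qed.

Lemma plength_word_le c : (plength (word_prod c) <= size c)%N.
Proof.
rewrite /plength; case: ex_minnP => m _; apply.
by apply/asboolP; exists c.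
Qed.

Lemma reduced_wordP (w : SZ) : exists2 c, size c = plength w & w = word_prod c.
Proof.
rewrite /plength; case: ex_minnP => m /asboolP[c [sc wc]] _.
by exists c.
Qed.

Lemma plength1 : plength 1%g = 0.
Proof. by apply/eqP; rewrite -leqn0 -word_prod0; exact: plength_word_le. Qed.

Lemma plength_mul_le (u v : SZ) :
  (plength (u * v)%g <= plength u + plength v)%N.
Proof.
have [b <- {1}->] := reduced_wordP u; have [c <- {1}->] := reduced_wordP v.
by rewrite -word_prod_cat -size_cat; exact: plength_word_le.
Qed.

Lemma plength_mul_s_le (u : SZ) a : (plength (u * s_ a)%g <= (plength u).+1)%N.
Proof.
have [c <- {1}->] := reduced_wordP u.
by rewrite -word_prod_rcons -(size_rcons c a); exact: plength_word_le.
Qed.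

(** Exchange property.  Apply the letters of c to the pair (a, a + 1), from the
    right: the order of the pair is eventually reversed, so some letter k meets
    it as (k, k + 1).  If v is the product of the letters after k, then
    s_k v = v s_a, hence the letter k can be dropped. *)
Lemma deletion c a : word_prod c (a + 1) < word_prod c a ->
  exists2 d, (size d).+1 = size c & word_prod d = (word_prod c * s_ a)%g.
Proof.
elim: c => [|k c IHc]; first by rewrite word_prod0 /=; lia.
rewrite word_prod_cons !SZ_mulE => lt_kc.
have [lt_c|] := ltP (word_prod c (a + 1)) (word_prod c a).
  have [d sd dE] := IHc lt_c; exists (k :: d); first by rewrite /= sd.
  by rewrite word_prod_cons dE mulgA.
move=> le_c; exists c => //; set v := word_prod c in lt_kc le_c *.
have va : v a != v (a + 1) by apply/eqP => /SZ_inj; lia.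
have [vak va1k] : v a = k /\ v (a + 1) = k + 1.
  by move: lt_kc; rewrite !s_E; do !case: eqP; lia.
suff svE : (s_ k * v)%g = (v * s_ a)%g by rewrite svE mul_sK.
apply: SZ_ext => j; have [->|ja] := eqVneq j a.
  by rewrite mul_s_l SZ_mulE s_E vak eqxx va1k.
have [->|ja1] := eqVneq j (a + 1).
  by rewrite mul_s_r SZ_mulE s_E va1k vak eqxx; case: eqP => //; lia.
rewrite mul_s_out // SZ_mulE s_E -{1}vak -va1k.
by rewrite !(inj_eq (@SZ_inj v)) (negPf ja) (negPf ja1).
Qed.

(** Comparing with [plength_mul_s_asc], right multiplication by s_a changes the
    length by one in the direction read off from the values at a and a + 1; no
    count of inversions is involved. *)
Lemma plength_mul_s_desc (u : SZ) a :
  u (a + 1) < u a -> plength u = (plength (u * s_ a)%g).+1.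
Proof.
have [c sc uc] := reduced_wordP u; rewrite {1 2}uc => /deletion[d sd].
rewrite -uc => dE; have := plength_word_le d.
have := plength_mul_s_le (u * s_ a)%g a.
by rewrite mul_sK dE; lia.
Qed.

Lemma plength_mul_s_asc (u : SZ) a :
  u a < u (a + 1) -> plength (u * s_ a)%g = (plength u).+1.
Proof.
move=> lt_u; rewrite (@plength_mul_s_desc (u * s_ a)%g a) ?mul_sK //.
by rewrite mul_s_l mul_s_r.
Qed.

Lemma SZ_ltNge (u : SZ) a : (u a < u (a + 1)) = ~~ (u (a + 1) < u a).
Proof.
have : u a != u (a + 1) by apply/eqP => /SZ_inj; lia.
lia.
Qed.

(** * Nilpotent operators and the Yang-Baxter relation *)

Section Operators.
Variable R : comNzRingType.
Implicit Types (f g : SZ -> R) (x y : R).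

(** The operator 1 + x u_a, where u_a sends |w> to |w s_a> if this is shorter and
    to 0 otherwise, written on coefficient functions: on those it is defined
    without any condition of finite support. *)
Definition nil_factor (a : int) x f : SZ -> R :=
  fun u => f u + (if u a < u (a + 1) then x * f (u * s_ a)%g else 0).

(** The exponential law encodes u_a^2 = 0. *)
Lemma nil_factorD a x y f :
  nil_factor a x (nil_factor a y f) = nil_factor a (x + y) f.
Proof.
apply: funext => u; rewrite /nil_factor mul_s_l mul_s_r mul_sK.
have [uu|] := ltP (u a); last by rewrite !addr0.
by rewrite ltNge ltW //=; ring.
Qed.

Lemma nil_factor0 a f : nil_factor a 0 f = f.
Proof. by apply: funext => u; rewrite /nil_factor mul0r if_same addr0. Qed.

Lemma s_comm a b : a + 1 < b -> (s_ a * s_ b)%g = (s_ b * s_ a)%g.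
Proof.
move=> ab; apply: SZ_ext => j; rewrite !SZ_mulE !s_E.
by do !case: eqP => //; lia.
Qed.

Lemma s_braid a :
  (s_ a * s_ (a + 1) * s_ a)%g = (s_ (a + 1) * s_ a * s_ (a + 1))%g.
Proof.
apply: SZ_ext => j; rewrite !SZ_mulE !s_E.
by do !case: eqP => //; lia.
Qed.

Lemma nil_factor_comm a b x y f : a + 1 < b ->
  nil_factor a x (nil_factor b y f) = nil_factor b y (nil_factor a x f).
Proof.
move=> ab; apply: funext => u; rewrite /nil_factor.
rewrite !(@mul_s_out u a b) ?(@mul_s_out u a (b + 1)) ?(@mul_s_out u b a)
  ?(@mul_s_out u b (a + 1)); [|lia..].
rewrite -!mulgA (s_comm ab).
by case: ifP => _; case: ifP => _; ring.
Qed.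

(** Yang-Baxter relation. *)
Lemma nil_factor_braid a x y f :
  nil_factor a x (nil_factor (a + 1) (x + y) (nil_factor a y f)) =
  nil_factor (a + 1) y (nil_factor a (x + y) (nil_factor (a + 1) x f)).
Proof.
apply: funext => u; rewrite /nil_factor; set b := a + 1.
have al v : (v * s_ a)%g a = v b by exact: mul_s_l.
have ar v : (v * s_ a)%g b = v a by exact: mul_s_r.
have ao v : (v * s_ a)%g (b + 1) = v (b + 1) by apply: mul_s_out; lia.
have bo v : (v * s_ b)%g a = v a by apply: mul_s_out; lia.
rewrite ?(al, ar, ao, bo, mul_s_l, mul_s_r, mul_sK).
have -> : (u * s_ a * s_ b * s_ a = u * s_ b * s_ a * s_ b)%g.
  by rewrite -!mulgA ![(s_ _ * (_ * _))%g]mulgA s_braid.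
have ab : u a != u b by apply/eqP => /SZ_inj; lia.
have bc : u b != u (b + 1) by apply/eqP => /SZ_inj; lia.
have ac : u a != u (b + 1) by apply/eqP => /SZ_inj; lia.
(* Each relative order of the three values at a, b, b + 1 leaves a polynomial
   identity in x and y. *)
case: (ltP (u a) (u b)) => pq; case: (ltP (u b) (u (b + 1))) => qr;
case: (ltP (u a) (u (b + 1))) => pr; case: (ltP (u b) (u a)) => qp;
case: (ltP (u (b + 1)) (u b)) => rq; case: (ltP (u (b + 1)) (u a)) => rp;
  try lia; ring.
Qed.

Definition nil_prod (L : seq int) x f : SZ -> R :=
  foldr (fun a => nil_factor a x) f L.

Fixpoint segment (a : int) (n : nat) : seq int :=
  if n is m.+1 then a :: segment (a + 1) m else [::].

Lemma mem_segment a n k : (k \in segment a n) = (a <= k < a + n%:Z).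
Proof.
elim: n a => [|n IHn] a; first by rewrite in_nil; lia.
rewrite /= inE IHn; case: eqP; lia.
Qed.

Lemma nil_factor_nil_prod_comm a L x y f : {in L, forall b, a + 1 < b} ->
  nil_factor a x (nil_prod L y f) = nil_prod L y (nil_factor a x f).
Proof.
elim: L => //= b L IHL lt_aL.
rewrite nil_factor_comm ?lt_aL ?mem_head // IHL //.
by move=> c cL; rewrite lt_aL // inE cL orbT.
Qed.

(** With A = h_a A' and A' = h_(a+1) A'', write h_a(x) = h_a(y) h_a(x - y) and
    use the Yang-Baxter relation to get
      A(x) A(y) = h_a(y) h_a(x-y) h_(a+1)(x) h_a(y) A''(x) A'(y)
                = h_a(y) h_(a+1)(y) h_a(x) [h_(a+1)(x-y) A''(x) A'(y)].
    By induction A'(x) A'(y) = A'(y) A'(x); cancelling h_(a+1)(y) on the left,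
    the bracket is A''(y) A'(x), and A''(y) commutes with h_a(x). *)
Lemma nil_prod_comm a n x y f :
  nil_prod (segment a n) x (nil_prod (segment a n) y f) =
  nil_prod (segment a n) y (nil_prod (segment a n) x f).
Proof.
elim: n a f => [//|n IHn] a f.
case: n IHn => [|n] IHn; first by rewrite /= !nil_factorD addrC.
set L := segment (a + 1 + 1) n.
have segE z g : nil_prod (segment a n.+2) z g =
    nil_factor a z (nil_factor (a + 1) z (nil_prod L z g)).
  by [].
have segE' z g : nil_prod (segment (a + 1) n.+1) z g =
    nil_factor (a + 1) z (nil_prod L z g).
  by [].
have aL : {in L, forall b, a + 1 < b} by move=> b; rewrite mem_segment; lia.
have IH' : nil_factor (a + 1) (x - y)
             (nil_prod L x (nil_factor (a + 1) y (nil_prod L y f))) =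
           nil_prod L y (nil_factor (a + 1) x (nil_prod L x f)).
  rewrite (_ : x - y = - y + x); last by ring.
  by rewrite -nil_factorD -!segE' IHn (segE' y) nil_factorD addNr nil_factor0.
have hx g : nil_factor a x g = nil_factor a y (nil_factor a (x - y) g).
  by rewrite nil_factorD subrKC.
rewrite !segE [LHS]hx -(nil_factor_nil_prod_comm _ _ _ aL).
have := nil_factor_braid a (x - y) y; rewrite subrK => ->.
by rewrite IH' -(nil_factor_nil_prod_comm _ _ _ aL).
Qed.

End Operators.

(** * Increasing permutations and the expansion of the operators *)

Lemma word_fix c j :
  {in c, forall k, j != k /\ j != k + 1} -> word_prod c j = j.
Proof.
elim: c => [|k c IHc] cj; first by rewrite word_prod0.
rewrite word_prod_cons SZ_mulE IHc; last first.
  by move=> l lc; apply: cj; rewrite inE lc orbT.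
by have [/negPf jk /negPf jk1] := cj k (mem_head _ _); rewrite s_E jk jk1.
Qed.

Lemma word_le c k j : {in c, forall l, l < k} -> j <= k -> word_prod c j <= k.
Proof.
elim: c => [|l c IHc] ck jk; first by rewrite word_prod0.
rewrite word_prod_cons SZ_mulE; have lk := ck l (mem_head _ _).
have : word_prod c j <= k.
  by apply: IHc => // m mc; apply: ck; rewrite inE mc orbT.
by rewrite s_E; do !case: eqP; lia.
Qed.

(** Before the last and largest letter k is appended, position k + 1 is fixed
    and the value at k is at most k: there is an ascent at k. *)
Lemma plength_sorted_word c : sorted <%R c -> plength (word_prod c) = size c.
Proof.
elim/last_ind: c => [|c k IHc]; first by rewrite word_prod0 plength1.
rewrite lt_sorted_pairwise pairwise_rcons -lt_sorted_pairwise.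
move=> /andP[/allP /= ck /IHc lc].
rewrite word_prod_rcons size_rcons -lc plength_mul_s_asc //.
rewrite (@word_fix c (k + 1)); last by move=> l /ck; lia.
by have := @word_le c k k ck (lexx k); lia.
Qed.

(** One entry for each subset of the letters in [a, a + n). *)
Fixpoint incr_perms (a : int) (n : nat) : seq SZ :=
  if n is m.+1 then
    incr_perms (a + 1) m ++ [seq (s_ a * v)%g | v <- incr_perms (a + 1) m]
  else [:: 1%g].

Lemma mem_incr_permsP a n v :
  reflect (exists c, [/\ sorted <%R c, {in c, forall k, a <= k < a + n%:Z} &
                         v = word_prod c])
          (v \in incr_perms a n).
Proof.
apply: (iffP idP).
  elim: n a v => [|n IHn] a v /=.
    by rewrite inE => /eqP ->; exists [::]; rewrite word_prod0.
  rewrite mem_cat => /orP[/IHn[c [sc cP ->]]|/mapP[v' /IHn[c [sc cP ->]] ->]].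
    by exists c; split=> // k /cP; lia.
  exists (a :: c); rewrite word_prod_cons; split=> //=.
    rewrite lt_path_sortedE sc andbT.
    by apply/allP => k /cP; lia.
  by move=> k; rewrite inE => /predU1P[->|/cP]; lia.
move=> [c [sc cP ->]]; elim: n a c sc cP => [|n IHn] a c sc cP.
  case: c sc cP => [|k c] _ cP; first by rewrite /= word_prod0 mem_head.
  by have := cP k (mem_head _ _); lia.
rewrite /= mem_cat; apply/orP.
have [cE|[c' [-> sc' cP']]] : {in c, forall k, a + 1 <= k < a + 1 + n%:Z} \/
    exists c', [/\ c = a :: c', sorted <%R c' &
                   {in c', forall k, a + 1 <= k < a + 1 + n%:Z}].
- case: c sc cP => [|k c]; first by left.
  rewrite /= lt_path_sortedE => /andP[/allP /= kc sc] cP.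
  have [ka|ka] := eqVneq k a; [right; exists c; rewrite ka; split=> // l lc|].
    by have := kc l lc; have := cP l; rewrite inE lc orbT; lia.
  left=> l lkc; have kP := cP k (mem_head _ _); have lP := cP l lkc.
  by move: lkc; rewrite inE => /predU1P[lk|/kc]; lia.
- by left; apply: IHn.
by right; rewrite word_prod_cons; apply/map_f/IHn.
Qed.

Lemma incr_perms_fix a n v j : v \in incr_perms a n -> j < a -> v j = j.
Proof.
by move=> /mem_incr_permsP[c [_ cP ->]] ja; apply: word_fix => k /cP; lia.
Qed.

Lemma incr_perms_increasing a n v : v \in incr_perms a n -> increasing v.
Proof.
move=> /mem_incr_permsP[c [sc _ ->]]; right; exists c.
by rewrite plength_sorted_word.
Qed.

Lemma plength_s_incr_perms a n v :
  v \in incr_perms (a + 1) n -> plength (s_ a * v)%g = (plength v).+1.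
Proof.
move=> /mem_incr_permsP[c [sc cP ->]].
rewrite -word_prod_cons !plength_sorted_word //= lt_path_sortedE sc andbT.
by apply/allP => k /cP; lia.
Qed.

(** The two halves of the list are told apart by the image of a. *)
Lemma incr_perms_uniq a n : uniq (incr_perms a n).
Proof.
elim: n a => [//|n IHn] a /=.
rewrite cat_uniq IHn map_inj_uniq ?IHn; last first.
  exact: mulgI.
rewrite andbT; apply/hasPn => _ /mapP[v vX ->]; apply/negP => sX.
have := incr_perms_fix (j := a) sX.
rewrite SZ_mulE (incr_perms_fix vX) ?s_E ?eqxx; lia.
Qed.

Definition length_add (u v : SZ) :=
  plength (u * v)%g == (plength u + plength v)%N.

(** Expanding the product chooses a set of letters.  A letter is applied only at
    an ascent, which is why exactly the length-additive products survive. *)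
Lemma nil_prod_segment (R : comNzRingType) a n (x : R) f u :
  nil_prod (segment a n) x f u =
  \sum_(v <- incr_perms a n | length_add u v) x ^+ plength v * f (u * v)%g.
Proof.
elim: n a u => [|n IHn] a u /=.
  rewrite big_cons big_nil /length_add mulg1 plength1 addn0 eqxx.
  by rewrite expr0 mul1r addr0.
rewrite big_cat /= /nil_factor IHn; congr (_ + _); rewrite big_map IHn.
rewrite [RHS]big_seq_cond [RHS]big_mkcond /=.
case: ifPn => [asc|]; last first.
  rewrite SZ_ltNge negbK => /plength_mul_s_desc desc.
  rewrite [RHS]big1 // => v _.
  case: ifP => // /andP[vX].
  rewrite /length_add (plength_s_incr_perms vX) SZ_mulgA.
  by move=> /eqP e; have := plength_mul_le (u * s_ a)%g v; rewrite e desc; lia.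
rewrite mulr_sumr big_seq_cond big_mkcond; apply: eq_bigr => v _ /=.
rewrite /length_add SZ_mulgA (plength_mul_s_asc asc).
case vX: (v \in _) => //=; rewrite (plength_s_incr_perms vX) addSnnS.
by case: ifP => // _; rewrite exprS mulrA.
Qed.

Section Tuples.
Variable X : seq SZ.

Fixpoint tuples_over n : seq (n.-tuple SZ) :=
  if n is m.+1 return seq (n.-tuple SZ)
  then [seq cons_tuple v t | v <- X, t <- tuples_over m] else [:: [tuple]].

Lemma mem_tuples_over n (t : n.-tuple SZ) :
  (t \in tuples_over n) = all [in X] t.
Proof.
elim: n t => [|n IHn] t; first by rewrite tuple0 inE eqxx.
case/tupleP: t => v t /=; apply/allpairsP/andP => [[[v' t'] /= [vX t'X /eqP]]|].
  by rewrite -val_eqE /= => /eqP[-> ->]; split; rewrite -?IHn.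
by move=> [vX tX]; exists (v, t); split; rewrite //= IHn.
Qed.

Lemma tuples_over_uniq n : uniq X -> uniq (tuples_over n).
Proof.
move=> uX; elim: n => //= n IHn; apply: allpairs_uniq => //.
by move=> [v t] [v' t'] _ _ /= /eqP; rewrite -val_eqE => /eqP[-> /val_inj ->].
Qed.

End Tuples.

Lemma plength_prod_le (t : seq SZ) :
  (plength (\prod_(v <- t) v)%g <= \sum_(v <- t) plength v)%N.
Proof.
elim: t => [|v t IHt]; first by rewrite !big_nil plength1.
by rewrite !big_cons (leq_trans (plength_mul_le _ _)) ?leq_add2l.
Qed.

Definition length_add_seq (u : SZ) (t : seq SZ) :=
  plength (u * \prod_(v <- t) v)%g == (plength u + \sum_(v <- t) plength v)%N.

Lemma length_add_seq_cons u v t :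
  length_add_seq u (v :: t) = length_add u v && length_add_seq (u * v)%g t.
Proof.
have pE : (\prod_(w <- v :: t) w = v * \prod_(w <- t) w)%g by rewrite big_cons.
rewrite /length_add_seq /length_add pE big_cons SZ_mulgA.
have h1 := plength_mul_le (u * v)%g (\prod_(v <- t) v)%g.
have h2 := plength_prod_le t; have h3 := plength_mul_le u v.
by apply/eqP/andP => [e|[/eqP e1 /eqP e2]]; [split; apply/eqP|]; lia.
Qed.

(** Iterating the expansion: the outermost operator gives the leftmost factor. *)
Lemma foldr_nil_prod_segment (R : comNzRingType) a k n (x : 'I_n -> R) f u :
  foldr (nil_prod (segment a k)) f [seq x i | i <- enum 'I_n] u =
  \sum_(t <- tuples_over (incr_perms a k) n | length_add_seq u t)
    (\prod_(i < n) x i ^+ plength (tnth t i)) * f (u * \prod_(v <- t) v)%g.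
Proof.
elim: n x u => [|n IHn] x u.
  rewrite enum_ord0 big_cons /length_add_seq !big_nil addn0 mulg1 eqxx addr0.
  by rewrite big_ord0 mul1r.
rewrite enum_ordSl /= nil_prod_segment -map_comp.
rewrite big_mkcond [RHS]big_mkcond big_allpairs_dep /=; apply: eq_bigr => v _.
under [RHS]eq_bigr do rewrite length_add_seq_cons.
case: ifP => uv /=; last by rewrite big1.
rewrite IHn mulr_sumr big_mkcond; apply: eq_bigr => t _; case: ifP => // _.
rewrite big_ord_recl big_cons !mulrA SZ_mulgA tnth0; congr (_ * _ * _).
by apply: eq_bigr => i _; rewrite tnthS.
Qed.

Definition window (a : int) (n : nat) (w : SZ) :=
  forall j, j < a \/ a + n%:Z < j -> w j = j.

(** As w fixes every point below a and every point above a + n, no value crosses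
    either end of the window. *)
Lemma window_descent a n w k :
  window a n w -> w (k + 1) < w k -> a <= k < a + n%:Z.
Proof.
move=> ww desc; apply/andP; split.
  rewrite leNgt; apply/negP => ka.
  have wk : w k = k by apply: ww; left.
  have : w (w (k + 1)) = w (k + 1) by apply: ww; left; lia.
  by move=> /SZ_inj; lia.
rewrite ltNge; apply/negP => ka.
have wk : w (k + 1) = k + 1 by apply: ww; right; lia.
have : w (w k) = w k by apply: ww; right; lia.
by move=> /SZ_inj; lia.
Qed.

Lemma window_mul_s a n w k : window a n w -> a <= k < a + n%:Z ->
  window a n (w * s_ k)%g.
Proof. by move=> ww kP j jP; rewrite mul_s_out ?ww //; lia. Qed.

(** The last letter of a reduced word is a descent, so it lies in the window;
    removing it keeps the permutation in the window.  This bounds the letters of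
    all the factorizations counted by a Stanley polynomial, and reduces it to a
    finite sum known in advance. *)
Lemma window_letters a n u c :
  window a n (u * word_prod c)%g ->
  plength (u * word_prod c)%g = (plength u + size c)%N ->
  {in c, forall k, a <= k < a + n%:Z}.
Proof.
elim/last_ind: c => // c k IHc; rewrite word_prod_rcons size_rcons SZ_mulgA.
set w := (u * word_prod c)%g in IHc *; move=> ww lw.
have lc : (plength w <= plength u + size c)%N.
  apply: leq_trans (plength_mul_le _ _) _.
  by rewrite leq_add2l; exact: plength_word_le.
have wk : w k < w (k + 1).
  rewrite SZ_ltNge; apply/negP => /plength_mul_s_desc.
  by rewrite addnS in lw; move: lw lc; lia.
have kP : a <= k < a + n%:Z.
  by apply: (window_descent ww); rewrite mul_s_l mul_s_r.
move=> l; rewrite mem_rcons inE => /predU1P[->//|]; apply: IHc.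
  by rewrite -(mul_sK w k); apply: window_mul_s.
by rewrite (plength_mul_s_asc wk) addnS in lw; case: lw.
Qed.

(** * Skew Stanley polynomials as matrix coefficients *)

Lemma increasing_in_incr_perms a n u v p :
  window a n (u * v * p)%g ->
  plength (u * v * p)%g = (plength u + plength v + plength p)%N ->
  increasing v -> v \in incr_perms a n.
Proof.
move=> ww lw incv.
have [c [sc vE lc]] : exists c,
    [/\ sorted <%R c, v = word_prod c & plength v = size c].
  by case: incv => [->|//]; exists [::]; rewrite word_prod0 plength1.
have [d ld pE] := reduced_wordP p.
have cdE : (u * v * p = u * word_prod (c ++ d))%g.
  by rewrite word_prod_cat -vE -pE SZ_mulgA.
apply/mem_incr_permsP; exists c; split=> // k kc.
apply: (@window_letters a n u (c ++ d)); first by rewrite -cdE.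
  by rewrite -cdE lw size_cat lc ld addnA.
by rewrite mem_cat kc.
Qed.

Lemma increasing_factors_in_incr_perms a n u (t : seq SZ) :
  window a n (u * \prod_(v <- t) v)%g -> length_add_seq u t ->
  {in t, forall v, increasing v} -> {subset t <= incr_perms a n}.
Proof.
elim: t u => // v t IHt u; rewrite length_add_seq_cons.
have -> : (u * \prod_(z <- v :: t) z = u * v * \prod_(z <- t) z)%g.
  by rewrite big_cons mulgA.
move=> ww /andP[uv uvt] inct z; rewrite inE => /predU1P[->|]; last first.
  by apply: IHt ww uvt _ _ => y yt; apply: inct; rewrite inE yt orbT.
apply: increasing_in_incr_perms ww _ (inct v (mem_head _ _)).
apply/eqP; rewrite eqn_leq -(eqP uv) plength_mul_le /=.
by rewrite (eqP uvt) leq_add2l plength_prod_le.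
Qed.

Definition delta (R : comNzRingType) (w : SZ) : SZ -> R := fun u => (u == w)%:R.

Lemma reduced_prod2E u w : reduced_prod w [:: u; (u^-1 * w)%g] <->
  plength w = (plength u + plength (u^-1 * w)%g)%N.
Proof.
rewrite /reduced_prod !big_cons !big_nil mulg1 addn0.
by split=> [[]|lw] //; split=> //; rewrite mulVKg.
Qed.

(** In the expanded product the terms that hit w are the factorizations of
    u^-1 w with lengths adding up starting from l(u); they exist only if
    w = u (u^-1 w) is itself length-additive, and the lengths of the factors
    then add up to that of u^-1 w. *)
Lemma skew_stanleyE (R : comNzRingType) a k n (x : 'I_n -> R) u w :
  window a k w ->
  skew_stanley x w u =
  foldr (nil_prod (segment a k)) (delta R w) [seq x i | i <- enum 'I_n] u.
Proof.
move=> ww; rewrite foldr_nil_prod_segment.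
set v : SZ := (u^-1 * w)%g.
have prodE (t : seq SZ) :
  ((u * \prod_(z <- t) z)%g == w) = ((\prod_(z <- t) z)%g == v).
  by apply/eqP/eqP => e; rewrite ?e ?mulVKg /v -?e ?mulKg.
have -> : \sum_(t <- tuples_over (incr_perms a k) n | length_add_seq u t)
    (\prod_(i < n) x i ^+ plength (tnth t i)) *
      delta R w (u * \prod_(v <- t) v)%g =
  \sum_(t <- [seq t : n.-tuple SZ <- tuples_over (incr_perms a k) n |
               length_add_seq u t && ((u * \prod_(z <- t) z)%g == w)])
    \prod_(i < n) x i ^+ plength (tnth t i).
  rewrite big_filter big_mkcondr; apply: eq_bigr => t _.
  by rewrite /delta; case: eqP => _; rewrite ?mulr1 ?mulr0.
rewrite /skew_stanley; case: asboolP => [/reduced_prod2E lw|nred].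
  have {}lw : plength w = (plength u + plength v)%N by [].
  rewrite -/v.
  rewrite /stanley [RHS]fsbig_seq; last first.
    by rewrite filter_uniq ?tuples_over_uniq ?incr_perms_uniq.
  apply: eq_fsbigl; apply/seteqP; split=> t /=.
    move=> [inct [vE lv]].
    rewrite mem_filter mem_tuples_over prodE vE eqxx andbT.
    have uvE : (u * \prod_(z <- t) z)%g = w by rewrite -vE mulVKg.
    have ut : length_add_seq u t by rewrite /length_add_seq uvE lw lv.
    rewrite ut /=; apply/allP; apply: increasing_factors_in_incr_perms ut _.
      by rewrite uvE.
    by move=> z /tnthP[i ->].
  rewrite mem_filter mem_tuples_over prodE => /andP[/andP[ut /eqP tv] /allP tX].
  split=> [i|]; first exact/incr_perms_increasing/tX/mem_tnth.
  split; first by rewrite tv.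
  by move: ut; rewrite /length_add_seq tv mulVKg lw eqn_add2l => /eqP.
rewrite big1_seq // => t /=; rewrite mem_filter prodE.
move=> /andP[/andP[ut /eqP tv] _]; case: nred; apply/reduced_prod2E.
move: ut; rewrite /length_add_seq tv mulVKg => /eqP lw.
have h1 := plength_prod_le t; rewrite tv in h1.
have h2 : (plength w <= plength u + plength v)%N.
  by rewrite -{1}(mulVKg u w); exact: plength_mul_le.
by apply/eqP; rewrite eqn_leq h2 /= lw leq_add2l.
Qed.

(** * Tilings of one row *)

Lemma finite_int_bound (A : set int) : finite_set A ->
  exists M : int, forall i, A i -> M <= i.
Proof.
move=> /finite_fsetP[X ->]; exists (- (\max_(i <- X) `|i|%N)%:Z) => i iX.
have : (`|i| <= \max_(i <- X) `|i|)%N.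
  by rewrite (bigD1_seq i iX (fset_uniq X)); apply: leq_maxl.
lia.
Qed.

Lemma int_upward_ind (P : int -> Prop) (a : int) :
  P a -> (forall c, a <= c -> P c -> P (c + 1)) -> forall c, a <= c -> P c.
Proof.
move=> Pa PS c ac; have -> : c = a + (`|c - a|%N)%:Z by lia.
elim: `|_|%N => [|n IHn]; first by rewrite addr0.
by rewrite -addn1 PoszD addrA; apply: PS => //; lia.
Qed.

Lemma icoE (p q k : int) : `[p, q[%classic k = (p <= k < q) :> Prop.
Proof. by rewrite /= in_itv. Qed.

Lemma ico_eq0 (p q : int) : `[p, q[%classic = set0 <-> q <= p.
Proof.
split=> [e|qp].
  rewrite leNgt; apply/negP => pq.
  by have : (set0 : set int) p by rewrite -e icoE lexx.
by rewrite -subset0 => k; rewrite icoE => /andP[pk kq]; lia.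
Qed.

Lemma ico_inj (p q p' q' : int) : p < q ->
  `[p, q[%classic = `[p', q'[%classic -> p = p' /\ q = q'.
Proof.
move=> pq e.
have h k : (p <= k < q) = (p' <= k < q').
  by apply/idP/idP => hk; [have : `[p', q'[%classic k by rewrite -e icoE
     | have : `[p, q[%classic k by rewrite e icoE]; rewrite icoE.
have := h p; have := h p'; have := h (q - 1); have := h (q' - 1).
lia.
Qed.

(** The four kinds of tiles are the four ways in which the intervals [i, b) and
    [i, a) can be empty or not. *)
Lemma allowedP t : allowed t <-> exists i : int,
  [/\ i <= ttop t, i <= tbot t, tleft t = `[i, tbot t[%classic &
      tright t = `[i, ttop t[%classic].
Proof.
case: t => a b I J; rewrite /allowed /tile_vacant /tile_emit /tile_absorb.
rewrite /tile_through /=; split.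
  have eq0 k : `[k, k[%classic = set0 :> set int by apply/ico_eq0.
  case=> [[-> -> ->]|[ba -> ->]|[ab -> ->]|[i [iab -> ->]]].
  - by exists b; rewrite eq0.
  - by exists b; rewrite eq0; split=> //; lia.
  - by exists a; rewrite eq0; split=> //; lia.
  - by exists i; split=> //; lia.
move=> [i [ia ib -> ->]].
have [ib'|bi] := ltP i b; have [ia'|ai] := ltP i a.
- by apply: Or44; exists i; split=> //; lia.
- have -> : i = a by lia.
  by apply: Or43; split; [lia | | apply/ico_eq0].
- have -> : i = b by lia.
  by apply: Or42; split; [lia | apply/ico_eq0 |].
- have -> : a = b by lia.
  by apply: Or41; split=> //; apply/ico_eq0; lia.
Qed.

Lemma tile_weightE (R : comNzRingType) (x : R) t : allowed t ->
  tile_weight x t = if `[< tleft t = set0 >] then 1 else x.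
Proof.
move=> tP; rewrite /tile_weight; congr (if _ then _ else _).
apply/asboolP/asboolP => [[] []//|t0].
case: tP => [|||]; [by left | by right | |].
  by move=> [ab e _]; move: t0; rewrite e => /ico_eq0; lia.
by move=> [i [iab e _]]; move: t0; rewrite e => /ico_eq0; lia.
Qed.

(** A tiling with given boundaries is determined by its vertical edges, E c being
    the left edge of column c. *)
Definition edges (w u : SZ) (E : int -> set int) : Prop :=
  (forall c, exists i : int, [/\ i <= w c, i <= u c, E c = `[i, u c[%classic &
                                 E (c + 1) = `[i, w c[%classic]) /\
  finite_set [set c | E c <> set0].

Definition tiling_of (w u : SZ) (E : int -> set int) : int -> tile :=
  fun c => Tile (w c) (u c) (E c) (E (c + 1)).

Lemma tilings_edges w u t : tilings w u t ->
  edges w u (tleft \o t) /\ t = tiling_of w u (tleft \o t).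
Proof.
move=> [tA tT tB tE tF]; split.
  split=> // c; have /allowedP[i] := tA c; rewrite tT tB tE => iP.
  by exists i.
apply: funext => c; rewrite /tiling_of /= -tE -tT -tB.
by case: (t c).
Qed.

Lemma edges_tilings w u E : edges w u E -> tilings w u (tiling_of w u E).
Proof. by move=> [Ec Ef]; split=> // c; apply/allowedP/Ec. Qed.

Lemma edges_left_empty w u E : edges w u E -> exists M : int,
  forall c, c < M -> E c = set0.
Proof.
move=> [_ /finite_int_bound[M EM]]; exists M => c cM.
by apply: contrapT => /EM /=; lia.
Qed.

(** From left to right: the left edge of a column and its bottom label determine
    i, hence the right edge. *)
Lemma edges_unique w u E E' : edges w u E -> edges w u E' -> E = E'.
Proof.
move=> EP E'P; have [M EM] := edges_left_empty EP.
have [M' E'M] := edges_left_empty E'P.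
(* Both families are empty at m, where the induction starts. *)
pose m := Num.min M M' - 1.
apply: funext => c; have [mc|cm] := leP m c; last first.
  by rewrite EM ?E'M //; lia.
elim/int_upward_ind: c / mc => [|c _ Ec].
  by rewrite EM ?E'M //; lia.
have [i [ia ib Ei ->]] := EP.1 c; have [j [ja jb Ej ->]] := E'P.1 c.
suff -> : i = j by [].
have [ib'|bi] := ltP i (u c).
  by have [] := ico_inj ib' (etrans (esym Ei) (etrans Ec Ej)).
have /ico_eq0 : `[j, u c[%classic = set0 by rewrite -Ej -Ec Ei; apply/ico_eq0.
lia.
Qed.

Section Edges.
Variables (w u : SZ) (E : int -> set int).
Hypothesis EP : edges w u E.

(** As long as the two boundaries agree, no block can have started. *)
Lemma edges_empty (a : int) : (forall c, c < a -> u c = w c) ->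
  forall c, c <= a -> E c = set0.
Proof.
move=> uw; have [M EM] := edges_left_empty EP.
move=> c ca; have [mc|cm] := leP (M - 1) c; last by rewrite EM //; lia.
elim/int_upward_ind: c / mc ca => [|c _ IHc ca]; first by rewrite EM //; lia.
have [i [iw iu Ei ->]] := EP.1 c.
have /ico_eq0 : `[i, u c[%classic = set0 by rewrite -Ei IHc //; lia.
by rewrite uw; [move=> wi; apply/ico_eq0 | lia].
Qed.

Lemma edges_first (a : int) : (forall c, c < a -> u c = w c) ->
  u a <= w a /\ E (a + 1) = `[u a, w a[%classic.
Proof.
move=> uw; have [i [iw iu Ei ->]] := EP.1 a.
have /ico_eq0 ui : `[i, u a[%classic = set0 by rewrite -Ei (edges_empty uw).
by have <- : i = u a by lia.
Qed.

(** The first column where the boundaries differ starts a block: its right edge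
    is nonempty, and the tile on its right has to match both ends of it. *)
Lemma edges_next (a : int) : (forall c, c < a -> u c = w c) -> u a != w a ->
  [/\ u a < w a, u (a + 1) = w a, u a <= w (a + 1) &
      E (a + 1 + 1) = `[u a, w (a + 1)[%classic].
Proof.
move=> uw ne; have [le_uw Ea] := edges_first uw.
have lt_uw : u a < w a by rewrite lt_neqAle ne.
have [i [iw iu Ei ->]] := EP.1 (a + 1).
have [ui e] := ico_inj lt_uw (etrans (esym Ea) Ei).
by rewrite -ui; split=> //; lia.
Qed.

(** A block starts with a label smaller than w(a), which w takes at some position
    on the right of a since the boundaries agree on the left. *)
Lemma edges_fixed (a : int) : (forall c, c < a -> u c = w c) ->
  (forall j, a <= j -> w a <= w j) -> u a = w a.
Proof.
move=> uw min_wa; have [le_uw _] := edges_first uw.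
have [j jE] := SZ_surj w (u a).
have [ja|aj] := ltP j a.
  by move: jE; rewrite -uw // => /SZ_inj; lia.
by have := min_wa j aj; lia.
Qed.

End Edges.

Definition edges_weight (R : comNzRingType) (x : R) (E : int -> set int) : R :=
  \big[*%R/1]_(c \in [set: int]) if `[< E c = set0 >] then 1 else x.

Lemma Z_edges (R : comNzRingType) (x : R) w u E :
  edges w u E -> Z_ w u x = edges_weight x E.
Proof.
move=> EP; rewrite /Z_.
have -> : tilings w u = [set tiling_of w u E].
  apply/seteqP; split=> [t /tilings_edges[tP ->]|_ ->]; last first.
    exact: edges_tilings.
  by rewrite (edges_unique tP EP).
rewrite fsbig_set1; apply: eq_fsbigr => c _.
by rewrite tile_weightE //; apply/allowedP/EP.1.
Qed.

Lemma Z_no_edges (R : comNzRingType) (x : R) w u :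
  (forall E, ~ edges w u E) -> Z_ w u x = 0.
Proof.
move=> nE; rewrite /Z_ (_ : tilings w u = set0) ?fsbig_set0 //.
by rewrite -subset0 => t /tilings_edges[] /nE.
Qed.

Lemma Z_id (R : comNzRingType) (x : R) w : Z_ w w x = 1.
Proof.
rewrite (@Z_edges _ _ _ _ (fun=> set0)).
  by rewrite /edges_weight fsbig1 // => c _; case: asboolP.
split=> [c|]; first by exists (w c); split=> //; apply/esym/ico_eq0.
by rewrite (_ : [set c | _] = set0) // -subset0 => c /=.
Qed.

(** Emptying the first nonempty edge: the block that started in column a starts
    in column a + 1 instead, or disappears if it consisted of two columns. *)
Lemma edges_shrink (w u : SZ) E (a : int) :
  (forall c, c < a -> u c = w c) -> u a != w a -> edges w u E ->
  edges w (u * s_ a)%g (fun c => if c == a + 1 then set0 else E c).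
Proof.
move=> uw ne EP; have [lt_uw u1 le_uw Ea2] := edges_next EP uw ne.
have Ea := edges_empty EP uw (lexx a).
split=> [c|]; last first.
  by apply: sub_finite_set EP.2 => c /=; case: eqP.
have [->|ca] := eqVneq c a.
  exists (w a); rewrite mul_s_l u1; split=> //.
    rewrite Ea; case: eqP => _; apply/esym/ico_eq0 => //.
  by rewrite eqxx; apply/esym/ico_eq0.
have [->|ca1] := eqVneq c (a + 1).
  exists (u a); rewrite mul_s_r; split=> //; first exact/esym/ico_eq0.
  by rewrite Ea2; case: eqP => //; lia.
rewrite mul_s_out // (_ : (c + 1 == a + 1) = false); last by lia.
exact: EP.1.
Qed.

(** Inverse of [edges_shrink]. *)
Lemma edges_extend (w u : SZ) E (a : int) :
  (forall c, c < a -> u c = w c) -> u a < u (a + 1) -> u (a + 1) = w a ->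
  edges w (u * s_ a)%g E ->
  edges w u (fun c => if c == a + 1 then `[u a, w a[%classic else E c).
Proof.
move=> uw lt_u u1 EP.
have uw' c : c < a + 1 -> (u * s_ a)%g c = w c.
  move=> ca; have [->|ne] := eqVneq c a; first by rewrite mul_s_l.
  by rewrite mul_s_out ?uw //; lia.
have [le_uw Ea2] := edges_first EP uw'; rewrite mul_s_r in le_uw Ea2.
have E0 c : c <= a + 1 -> E c = set0 by exact: (edges_empty EP uw').
split=> [c|]; last first.
  apply: (@sub_finite_set _ _ ([set a + 1] `|` [set c | E c <> set0])).
    by move=> c /=; case: eqP => [->|]; [left | right].
  by rewrite finite_setU; split; [exact: finite_set1 | exact: EP.2].
have [->|ca] := eqVneq c a.
  exists (u a); rewrite eqxx -u1; split=> //; first exact: ltW.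
  by case: eqP => [|_]; [lia | rewrite E0 ?lerDl //; apply/esym/ico_eq0].
have [->|ca1] := eqVneq c (a + 1).
  exists (u a); rewrite u1; split=> //; first by rewrite -u1 ltW.
  by rewrite Ea2; case: eqP => //; lia.
rewrite (_ : (c + 1 == a + 1) = false); last by lia.
by have := EP.1 c; rewrite mul_s_out.
Qed.

Lemma edges_weight_extend (R : comNzRingType) (x : R) (E : int -> set int) b I :
  finite_set [set c | E c <> set0] -> E b = set0 -> I <> set0 ->
  edges_weight x (fun c => if c == b then I else E c) = x * edges_weight x E.
Proof.
move=> /finite_fsetP[X EX] Eb I0.
have XE c : c \in X = `[< E c <> set0 >].
  have e : (c \in X : Prop) = (E c <> set0).
    by have := congr1 (fun A : set int => A c) EX.
  by apply/idP/asboolP; rewrite -e.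
have bX : b \notin X by rewrite XE; apply/asboolP; rewrite Eb.
rewrite /edges_weight (@fsbigTE _ _ _ _ (b |` X)%fset); last first.
  move=> c; rewrite !inE XE negb_or => /andP[/negPf -> /asboolP /contrapT Ec].
  by case: asboolP.
rewrite big_fsetU1 //= eqxx (_ : `[< I = set0 >] = false); last first.
  exact/asboolP.
rewrite (@fsbigTE _ _ _ _ X); last first.
  by move=> c; rewrite XE => /asboolP /contrapT Ec; case: asboolP.
congr (_ * _); apply: eq_big_seq => c cX.
by case: eqP => // cb; rewrite -cb cX in bX.
Qed.

(** * The transfer matrix *)

Definition coeffs (R : comNzRingType) (F : Fock R) : SZ -> R :=
  fun u => coeff u F.

Section TransferCoefficients.
Variables (R : comNzRingType) (x : R).

Lemma nil_prod_delta_agree (a : int) n w u :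
  nil_prod (segment a n) x (delta R w) u <> 0 -> forall j, j < a -> u j = w j.
Proof.
move=> nz j ja; apply: contrapT => uwj; case: nz.
rewrite nil_prod_segment big1_seq // => v /andP[_ vX]; rewrite /delta.
case: eqP => [uvw|_]; last by rewrite mulr0.
by case: uwj; rewrite -uvw SZ_mulE (incr_perms_fix vX).
Qed.

(** Induction on the letters, removing the smallest one, a; the boundaries are
    supposed to agree on the left of a.  If u(a) = w(a), the letter a is not used
    and column a is vacant.  Otherwise column a starts a block, which forces
    u(a) < u(a+1) = w(a), and emptying the edge after column a gives the tiling
    of w / (u s_a); the weight loses one factor x. *)
Lemma Z_nil_prod_right (a : int) n (w u : SZ) :
  (forall j, a + n%:Z < j -> w j = j) ->
  (forall c, c < a -> u c = w c) ->
  Z_ w u x = nil_prod (segment a n) x (delta R w) u.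
Proof.
elim: n a u => [|n IHn] a u wid uw.
  rewrite /= /delta; have [->|ne] := eqVneq u w; first exact: Z_id.
  apply: Z_no_edges => E EP; case/eqP: ne; apply: SZ_ext => c.
  suff uwc : forall c : int, a <= c -> forall j : int, j < c -> u j = w j.
    by apply: (uwc (Num.max a (c + 1)) _ c); lia.
  apply: int_upward_ind => [//|{}c ac IHc j jc].
  have [->|jc'] := eqVneq j c; last by apply: IHc; lia.
  apply: (edges_fixed EP IHc) => k ck.
  have [->|kc] := eqVneq k c; first exact: lexx.
  have wc : w c <= c.
    rewrite leNgt; apply/negP => cw.
    have /SZ_inj : w (w c) = w c by apply: wid; lia.
    lia.
  by rewrite (wid k); lia.
have wid' j : a + 1 + n%:Z < j -> w j = j by move=> ?; apply: wid; lia.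
have agree (v : SZ) : v a <> w a ->
    nil_prod (segment (a + 1) n) x (delta R w) v = 0.
  move=> va; apply: contrapT => /nil_prod_delta_agree /(_ a).
  rewrite ltrDl => va'.
  exact/va/va'.
rewrite /= {1}/nil_factor; have [ua|ua] := eqVneq (u a) (w a).
  rewrite (agree (u * s_ a)%g); last first.
    by rewrite mul_s_l -ua => /SZ_inj; lia.
  rewrite mulr0 if_same addr0; apply: IHn => // c ca.
  by have [->//|ne] := eqVneq c a; apply: uw; lia.
rewrite (agree u) ?add0r; last exact/eqP.
have [ua1|ua1] := eqVneq (u (a + 1)) (w a); last first.
  rewrite agree ?mul_s_l; last exact/eqP.
  rewrite mulr0 if_same; apply: Z_no_edges => E EP.
  by have [_ e _ _] := edges_next EP uw ua; rewrite e eqxx in ua1.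
case: ifPn => [lt_u|/negP nlt_u]; last first.
  apply: Z_no_edges => E EP.
  by have [lt_u e _ _] := edges_next EP uw ua; rewrite e in nlt_u.
rewrite -IHn //; last first.
  move=> c ca; have [->|ne] := eqVneq c a; first by rewrite mul_s_l.
  by rewrite mul_s_out ?uw //; lia.
have [[E EP]|nE] := pselect (exists E, edges w (u * s_ a)%g E); last first.
  rewrite [in RHS]Z_no_edges ?mulr0; last by move=> E EP; apply: nE; exists E.
  apply: Z_no_edges => E EP; apply: nE.
  by exists (fun c => if c == a + 1 then set0 else E c); apply: edges_shrink.
rewrite (Z_edges x EP) (Z_edges x (edges_extend uw lt_u ua1 EP)).
rewrite edges_weight_extend //; first exact: EP.2.
  apply: (edges_empty EP (a := a + 1)) => // c ca.
  have [->|ne] := eqVneq c a; first by rewrite mul_s_l.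
  by rewrite mul_s_out ?uw //; lia.
by move/ico_eq0; rewrite -ua1; lia.
Qed.

(** On the left of the window w is the identity, so that no block can start
    there: the boundaries agree and [Z_nil_prod_right] applies. *)
Lemma Z_nil_prod (a : int) n (w u : SZ) : window a n w ->
  Z_ w u x = nil_prod (segment a n) x (delta R w) u.
Proof.
move=> ww; have [uw|nuw] := pselect (forall c, c < a -> u c = w c).
  by apply: Z_nil_prod_right => // j aj; apply: ww; right.
have -> : nil_prod (segment a n) x (delta R w) u = 0.
  by apply: contrapT => /nil_prod_delta_agree.
apply: Z_no_edges => E EP; apply: nuw => c ca.
have [M uM] := finite_int_bound (SZ_fin u).
have fixM j : j < M -> u j = j.
  by move=> jM; apply/eqP; apply: contraT => /uM; lia.
suff: forall d : int, Num.min M a <= d -> d <= a ->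
    forall j : int, j < d -> u j = w j.
  by move=> /(_ a); apply; lia.
apply: int_upward_ind => [_ j jM|d _ IHd da j jd].
  by rewrite fixM ?ww //; [left|]; lia.
have uwd : forall j, j < d -> u j = w j by apply: IHd; lia.
have [->|ne] := eqVneq j d; last by apply: uwd; lia.
apply: (edges_fixed EP uwd) => k dk; rewrite (ww d); last by left; lia.
rewrite leNgt; apply/negP => wk.
have /SZ_inj : w (w k) = w k by apply: ww; left; lia.
lia.
Qed.

(** The letters stay in the window, so iterating the transfer matrix never leaves
    the permutations for which [Z_nil_prod] holds. *)
Lemma nil_prod_window a n (f : SZ -> R) :
  (forall u, f u <> 0 -> window a n u) ->
  forall u, nil_prod (segment a n) x f u <> 0 -> window a n u.
Proof.
move=> fP u; rewrite nil_prod_segment => nz j jP.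
apply: contrapT => uj; case: nz.
rewrite big1_seq // => v /andP[_ /mem_incr_permsP[c [_ cP vE]]].
suff -> : f (u * v)%g = 0 by rewrite mulr0.
apply: contrapT => /fP /(_ j jP); rewrite SZ_mulE vE word_fix // => k /cP.
by lia.
Qed.

Lemma coeff_transfer_ket a n w u : window a n w ->
  coeff u (\sum_(v \in [set: SZ]) Z_ w v x *: (<< v >> : {freeg SZ / R})) =
  Z_ w u x.
Proof.
move=> ww; have [Y YP] : exists Y : seq SZ,
    forall v, v \notin Y -> Z_ w v x = 0.
  exists [seq (w * z^-1)%g | z <- incr_perms a n] => v vY.
  rewrite (Z_nil_prod v ww) nil_prod_segment big1_seq // => z /andP[_ zX].
  rewrite /delta.
  case: eqP => [vzw|_]; last by rewrite mulr0.
  by case/negP: vY; apply/mapP; exists z; rewrite // -vzw mulgK.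
rewrite (@fsbigTE _ _ _ _ [fset v in Y]%fset); last first.
  by move=> v; rewrite inE => /YP ->; rewrite scale0r.
rewrite raddf_sum /=; under eq_bigr do rewrite coeffZ coeffU mul1r.
have [uY|uY] := boolP (u \in Y).
  rewrite (bigD1_seq u) ?inE ?fset_uniq //= eqxx mulr1 big1 ?addr0 //.
  by move=> v /negPf ->; rewrite mulr0.
rewrite (YP u uY) big1_seq // => v; rewrite inE => /andP[_ vY].
by case: eqP uY vY => [->|]; rewrite ?mulr0 // => /negPf ->.
Qed.

Lemma coeff_transfer a n (F : Fock R) :
  (forall u, coeff u F <> 0 -> window a n u) ->
  coeffs (transfer x F) = nil_prod (segment a n) x (coeffs F).
Proof.
move=> FP; apply: funext => u.
have FE v : coeff v F = \sum_(w <- dom F) coeff w F * delta R w v.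
  rewrite -{1}(freeg_sumE F) raddf_sum; apply: eq_bigr => w _.
  by rewrite /= coeffU /delta eq_sym.
have TE : transfer x F = \sum_(w <- dom F) coeff w F *:
    (\sum_(v \in [set: SZ]) Z_ w v x *: (<< v >> : {freeg SZ / R})).
  by rewrite /transfer -[in LHS](Freeg_dom F) fglift_Freeg /prelift big_map.
rewrite /coeffs TE raddf_sum /= nil_prod_segment.
under [RHS]eq_bigr do rewrite FE mulr_sumr.
rewrite exchange_big /=; apply: eq_big_seq => w; rewrite mem_dom => /eqP wF.
rewrite coeffZ (coeff_transfer_ket u (FP w wF)) (Z_nil_prod u (FP w wF)).
by rewrite nil_prod_segment mulr_sumr; apply: eq_bigr => v _; rewrite mulrCA.
Qed.

End TransferCoefficients.

(** The left side applies the parameters in the order of s, the right side in the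
    reverse order: this is where commutativity is used. *)
Lemma foldl_transfer (R : comNzRingType) a k (s : seq R) (F : Fock R) :
  (forall u, coeff u F <> 0 -> window a k u) ->
  coeffs (foldl (fun G x => transfer x G) F s) =
  foldr (nil_prod (segment a k)) (coeffs F) s.
Proof.
elim: s F => //= x s IHs F FP; have TF := coeff_transfer x FP.
rewrite IHs => [|u]; last first.
  by rewrite [coeff u _](congr1 (@^~ u) TF); exact: nil_prod_window.
rewrite TF; elim: s {IHs} => //= y s ->; exact: nil_prod_comm.
Qed.

Lemma window_exists (w : SZ) : exists a k, window a k w.
Proof.
have [M wM] := finite_int_bound (SZ_fin w).
have fN : finite_set [set - i | i in [set i : int | w i != i]].
  exact/finite_image/SZ_fin.
have [N wN] := finite_int_bound fN.
exists M, (absz (- N - M)) => j jP; apply/eqP; apply: contraT => wj.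
have := wM j wj; have : N <= - j by apply: wN; exists j.
by case: jP; lia.
Qed.

Theorem theorem4p4 (R : comNzRingType) (n : nat) (n_ge1 : (1 <= n)%N)
    (x : 'I_n -> R) (u w : SZ) :
  bracket u (transfer_prod x) w = skew_stanley x w u.
Proof.
have [a [k ww]] := window_exists w.
rewrite (skew_stanleyE x u ww) /bracket /transfer_prod.
have -> : foldl (fun A i => transfer (x i) \o A) id (enum 'I_n) (ket R w) =
          foldl (fun G y => transfer y G) (ket R w) [seq x i | i <- enum 'I_n].
  rewrite -[X in foldl _ X (map _ _)]/(id (ket R w)).
  by elim: (enum 'I_n) (id) => //= i s IHs A; rewrite IHs.
have ketE : coeffs (ket R w) = delta R w.
  by apply: funext => v; rewrite /coeffs /ket coeffU mul1r eq_sym.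
have ketW v : coeff v (ket R w) <> 0 -> window a k v.
  by rewrite -/(coeffs _ v) ketE /delta; case: eqP => [->|].
by rewrite -/(coeffs _ u) (foldl_transfer _ ketW) ketE.
Qed.
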